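(* Let $\mathcal{I}=\{I_n\}_{n\in\mathbb{N}_0}$ be a countable sequence of ranking indices $I_n:\operatorname{FN}(\mathbb{R})\to\mathbb{R}$, each increasing on the $\alpha$-cuts, i.e. for all $A,B\in\operatorname{FN}(\mathbb{R})$, $A\le_{KY}B$ implies $I_n(A)\le I_n(B)$ for all $n\in\mathbb{N}_0$. Then the sequential total preorder $\le_{\Phi_{\mathcal{I}}}$ on $\operatorname{FN}(\mathbb{R})$, where $\Phi_{\mathcal{I}}(A)=\{I_n(A)\}_{n\in\mathbb{N}_0}\in\operatorname{seq}(\mathbb{R})$, is an admissible total preorder.
   Context: A fuzzy set on $\mathbb{R}$ is a map $A:\mathbb{R}\to[0,1]$; for $\alpha\in(0,1]$, $A_\alpha=\{x:A(x)\ge\alpha\}$, and $A_0$ is the closure of the support $\bigcup_{\alpha\in(0,1]}A_\alpha$. $A$ is a fuzzy number if $A_1\ne\emptyset$, $A_0$ is bounded, and $A_\alpha=[\underline{A}_\alpha,\overline{A}_\alpha]$ is a closed interval for each $\alpha\in(0,1]$ (same endpoint notation for $\alpha=0$); $\operatorname{FN}(\mathbb{R})$ is the set of fuzzy numbers. The Klir–Yuan partial order is: $A\le_{KY}B$ iff $\underline{A}_\alpha\le\underline{B}_\alpha$ and $\overline{A}_\alpha\le\overline{B}_\alpha$ for all $\alpha\in[0,1]$. A total preorder $\le_{adm}$ on $\operatorname{FN}(\mathbb{R})$ is admissible if $A\le_{KY}B$ implies $A\le_{adm}B$. A ranking index is a mapping $\operatorname{FN}(\mathbb{R})\to\mathbb{R}$.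 $\operatorname{seq}(\mathbb{R})=\mathbb{R}^{\mathbb{N}_0}$ with $\mathbb{N}_0=\{0,1,2,\dots\}$, and $\mathfrak a\sqsubseteq\mathfrak b$ means that either $\mathfrak a=\mathfrak b$, or there is $n_0\in\mathbb{N}_0$ with $a_n=b_n$ for all $n<n_0$ and $a_{n_0}<b_{n_0}$. The sequential relation is $A\le_{\Phi_{\mathcal{I}}}B\iff\Phi_{\mathcal{I}}(A)\sqsubseteq\Phi_{\mathcal{I}}(B)$. *)

(* Defs.v *)
From Corelib Require Import RelationClasses.
From mathcomp Require Import all_boot all_order all_algebra.
From mathcomp Require Import all_classical all_reals all_analysis.

Set Implicit Arguments.
Unset Strict Implicit.
Unset Printing Implicit Defensive.

Import Order.TTheory GRing.Theory Num.Theory.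
Import numFieldNormedType.Exports.

Local Open Scope classical_set_scope.
Local Open Scope ring_scope.

Record fuzzy_set (R : realType) := FuzzySet {
  membership :> R -> R;
  membership_01 : forall x, 0 <= membership x <= 1 }.

Definition level_set (R : realType) (A : fuzzy_set R) (alpha : R) : set R :=
  [set x | alpha <= A x].

Definition fsupport (R : realType) (A : fuzzy_set R) : set R :=
  \bigcup_(alpha in `]0, 1]%classic) level_set A alpha.

(* Only meaningful for alpha in [0, 1]. *)
Definition cut (R : realType) (A : fuzzy_set R) (alpha : R) : set R :=
  if alpha == 0 then closure (fsupport A) else level_set A alpha.

(* Since the 1-cut is nonempty and contained in every alpha-cut, the interval
   `[a, b] below is never empty, so a <= b need not be required. *)
Definition is_fuzzy_number (R : realType) (A : fuzzy_set R) : Prop :=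
  [/\ cut A 1 !=set0,
      bounded_set (cut A 0) &
      forall alpha : R, 0 < alpha <= 1 ->
        exists a b : R, cut A alpha = `[a, b]%classic].

Record FN (R : realType) := FuzzyNumber {
  fuzzy_set_of :> fuzzy_set R;
  FN_fuzzy_number : is_fuzzy_number fuzzy_set_of }.

(* The endpoints of the alpha-cut, also for alpha = 0: see FN_cutE. *)
Definition lower (R : realType) (A : FN R) (alpha : R) : R := inf (cut A alpha).
Definition upper (R : realType) (A : FN R) (alpha : R) : R := sup (cut A alpha).

Definition le_KY (R : realType) (A B : FN R) : Prop :=
  forall alpha : R, 0 <= alpha <= 1 ->
    lower A alpha <= lower B alpha /\ upper A alpha <= upper B alpha.

Definition total_preorder (T : Type) (le : T -> T -> Prop) : Prop :=
  RelationClasses.PreOrder le /\ forall x y, le x y \/ le y x.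

Definition admissible_total_preorder (R : realType)
    (le_adm : FN R -> FN R -> Prop) : Prop :=
  total_preorder le_adm /\ forall A B : FN R, le_KY A B -> le_adm A B.

Definition ranking_index (R : realType) : Type := FN R -> R.

Definition increasing_on_cuts (R : realType) (I : ranking_index R) : Prop :=
  forall A B : FN R, le_KY A B -> I A <= I B.

Definition seq_lexi (R : realType) (a b : R^nat) : Prop :=
  a = b \/
  exists n0 : nat, (forall n : nat, (n < n0)%N -> a n = b n) /\ a n0 < b n0.

Definition Phi (R : realType) (I : nat -> ranking_index R) (A : FN R) : R^nat :=
  fun n => I n A.

Definition le_Phi (R : realType) (I : nat -> ranking_index R)
    (A B : FN R) : Prop :=
  seq_lexi (Phi I A) (Phi I B).

Lemma closed_interval_infsup (R : realType) (X : set R) :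
  X !=set0 -> bounded_set X -> closed X -> is_interval X ->
  X = `[inf X, sup X]%classic.
Proof.
move=> X0 bX cX iX.
have [hu hl] : has_ubound X /\ has_lbound X.
  have [M [_ HM]] := bX.
  have HM1 x : X x -> `|x| <= M + 1 by apply: HM; rewrite ltrDl.
  split; [exists (M + 1) | exists (- (M + 1))] => x /HM1;
    by rewrite ler_norml => /andP[].
have cl x : closure X x -> X x by rewrite -(closure_id _).1.
apply/seteqP; split => x /=.
  move=> Xx; rewrite in_itv /=; apply/andP; split; first exact: ge_inf.
  exact: ub_le_sup.
rewrite in_itv /=; apply: iX; apply: cl; last exact: closure_sup.
move=> U /nbhs_ballP[e /= e0 eU].
have [y Xy ye] := inf_adherent e0 (conj X0 hl).
exists y; split => //; apply: eU.
by rewrite /ball /= distrC ger0_norm ?subr_ge0 ?ge_inf// ltrBlDl.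
Qed.

Lemma FN_cutE (R : realType) (A : FN R) (alpha : R) : 0 <= alpha <= 1 ->
  cut A alpha = `[lower A alpha, upper A alpha]%classic.
Proof.
have [[x0 A1x0] bA cA] := FN_fuzzy_number A.
have cutE (a : R) : 0 < a -> cut A a = level_set A a.
  by move=> a0; rewrite /cut gt_eqF.
have cut0 : cut A 0 = closure (fsupport A) by rewrite /cut eqxx.
have x0P (a : R) : 0 < a <= 1 -> level_set A a x0.
  move=> /andP[_ a1]; move: A1x0; rewrite cutE//; exact: le_trans.
have subS (a : R) : 0 < a <= 1 -> level_set A a `<=` fsupport A.
  by move=> a01 x Ax; exists a => //=; rewrite in_itv.
case/andP; rewrite le_eqVlt => /predU1P[<- _|a0 a1]; last first.
  have a01 : 0 < alpha <= 1 by rewrite a0.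
  have [a [b ab]] := cA _ a01.
  apply: closed_interval_infsup.
  - by exists x0; rewrite cutE//; exact: x0P.
  - have [M [Mr HM]] := bA; exists M; split => // y /HM + x Ax; apply.
    rewrite cut0; apply: subset_closure; apply: (subS alpha) => //.
    by rewrite -cutE.
  - rewrite ab; exact: interval_closed.
  - rewrite ab; exact: interval_is_interval.
apply: (closed_interval_infsup _ bA); rewrite cut0.
- exists x0; apply: subset_closure; apply: (subS 1).
    by rewrite ltr01 lexx.
  by apply: x0P; rewrite ltr01 lexx.
- exact: closed_closure.
- apply/connected_intervalP/connected_closure/bigcup_connected.
    by exists x0 => a /=; rewrite in_itv /=; exact: x0P.
  move=> a /=; rewrite in_itv /= => a01; have [c [d cd]] := cA _ a01.
  rewrite -cutE ?cd; last by case/andP: a01.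
  exact/connected_intervalP/interval_is_interval.
Qed.

(* Main.v *)
(* Two distinct sequences are compared by [seq_lexi] at the first index where
   they differ; this gives totality, and it gives monotonicity in the strong form
   that a pointwise inequality implies the lexicographic one. *)
Require Import Defs.
From mathcomp Require Import all_boot all_order all_algebra.
From mathcomp Require Import all_classical all_reals all_analysis.

Import Order.TTheory.

(** Classically, sequences that are not pointwise equal disagree at some index; as [!=] on an
    [eqType] is boolean, [ex_minnP] yields the least one. *)
Lemma seq_first_difference (T : eqType) (a b : nat -> T) :
  a = b \/ exists n0, (forall n, (n < n0)%N -> a n = b n) /\ a n0 != b n0.
Proof.
have [/funext|/existsNP[m /eqP abm]] := pselect (forall n, a n = b n).
  by left.
right; have [n0 abn0 n0_min] := ex_minnP (ex_intro (fun n => a n != b n) m abm).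
exists n0; split=> // n nn0; apply/eqP/negPn/negP => /n0_min.
by rewrite leqNgt nn0.
Qed.

Lemma seq_lexi_refl (R : realType) (a : nat -> R) : seq_lexi a a.
Proof. by left. Qed.

Lemma seq_lexi_trans (R : realType) (a b c : nat -> R) :
  seq_lexi a b -> seq_lexi b c -> seq_lexi a c.
Proof.
move=> [->//|[m [abE ab]]] [<-|[k [bcE bc]]]; first by right; exists m.
(* The witness is the smaller of [m] and [k]: below it all three sequences agree. If [m] and [k]
   differ, one comparison is strict there and the other an equality; if they coincide, both are
   strict. *)
right; case: (ltngtP m k) => [mk|km|mkE].
- exists m; split; last by rewrite -bcE.
  by move=> n nm; rewrite abE ?bcE// (ltn_trans nm).
- exists k; split; last by rewrite abE.
  by move=> n nk; rewrite abE ?bcE// (ltn_trans nk).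
- exists m; split; last by apply: lt_trans ab _; rewrite mkE.
  by move=> n nm; rewrite abE ?bcE// -mkE.
Qed.

Lemma seq_lexi_total (R : realType) (a b : nat -> R) :
  seq_lexi a b \/ seq_lexi b a.
Proof.
have [->|[n0 [abE]]] := seq_first_difference _ a b; first by left; left.
rewrite neq_lt => /orP[ab|ba]; [left|right]; right; exists n0; split=> //.
by move=> n /abE.
Qed.

Lemma seq_lexi_pointwise (R : realType) (a b : nat -> R) :
  (forall n, a n <= b n)%R -> seq_lexi a b.
Proof.
move=> ab; have [->|[n0 [abE abn0]]] := seq_first_difference _ a b.
  exact: seq_lexi_refl.
by right; exists n0; split=> //; rewrite lt_neqAle abn0 ab.
Qed.

Theorem theorem6p2 (R : realType) (I : nat -> ranking_index R)
    (hI : forall n : nat, increasing_on_cuts (I n)) :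
  admissible_total_preorder (le_Phi I).
Proof.
split; first split; first split.
- by move=> A; exact: seq_lexi_refl.
- by move=> A B C; exact: seq_lexi_trans.
- by move=> A B; exact: seq_lexi_total.
(* Monotonicity of each [I n] turns [le_KY] into a termwise inequality of the index sequences. *)
- by move=> A B AB; apply: seq_lexi_pointwise => n; exact: hI.
Qed.
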